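(* Let $W,M$ be disjoint with $|W|=|M|=n$ and let $(w,m)\in W\times M$ be fixed. The randomized two-party communication complexity of determining whether $(w,m)$ is contained in some stable marriage (respectively, in every stable marriage) of the market $(W,M,\succ_W,\succ_M)$, where Alice holds the women's full preference profile $\succ_W$ and Bob holds the men's full preference profile $\succ_M$, is $\Omega(n^2)$.
   Context: A full preference profile of the women gives each woman a total order on $M$; that of the men gives each man a total order on $W$. A (perfect) marriage is a bijection between $W$ and $M$, identified with its set of married pairs. A pair $(w,m)$ is blocking for $\mu$ if $w$ prefers $m$ to her spouse in $\mu$ and $m$ prefers $w$ to his spouse in $\mu$; $\mu$ is stable if it has no blocking pair. In two-party communication complexity, the cost of a protocol is the number of bits exchanged in the worst case; a randomized protocol must answer correctly with probability at least $2/3$ on every input; the complexity is the least cost of such a protocol. The bound is asymptotic in $n$. *)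

(* Defs.v *)
From HB Require Import structures.
From mathcomp Require Import all_boot all_order all_algebra all_fingroup.
Set Implicit Arguments. Unset Strict Implicit. Unset Printing Implicit Defensive.
Import Order.TTheory GRing.Theory Num.Theory.

(* A full preference profile: for each agent a bijective rank function on the
   other side; rank 0 = most preferred.  [p a b < p a c] means a prefers b to c. *)
Definition profile (n : nat) := {ffun 'I_n -> {perm 'I_n}}.

(* A perfect marriage: bijection from women to men (mu w = husband of w). *)
Definition marriage (n : nat) := {perm 'I_n}.

Definition blocking (n : nat) (pW pM : profile n) (mu : marriage n)
    (w : 'I_n) (m : 'I_n) : bool :=
  (pW w m < pW w (mu w))%N && (pM m w < pM m ((mu^-1)%g m))%N.

Definition stable (n : nat) (pW pM : profile n) (mu : marriage n) : bool :=
  [forall w, forall m, ~~ blocking pW pM mu w m].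

Definition in_some_stable (n : nat) (w m : 'I_n) (pW pM : profile n) : bool :=
  [exists mu : marriage n, stable pW pM mu && (mu w == m)].

Definition in_every_stable (n : nat) (w m : 'I_n) (pW pM : profile n) : bool :=
  [forall mu : marriage n, stable pW pM mu ==> (mu w == m)].

(* Deterministic protocol tree: Alice (input X) or Bob (input Y) sends one bit
   computed from her/his input; leaves output the answer. *)
Inductive proto (X Y : Type) : Type :=
| Leaf of bool
| ANode of (X -> bool) & proto X Y & proto X Y   (* children: bit false / true *)
| BNode of (Y -> bool) & proto X Y & proto X Y.

Fixpoint run (X Y : Type) (P : proto X Y) (x : X) (y : Y) : bool :=
  match P with
  | Leaf b => b
  | ANode f P0 P1 => if f x then run P1 x y else run P0 x y
  | BNode g P0 P1 => if g y then run P1 x y else run P0 x y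
  end.

Fixpoint depth (X Y : Type) (P : proto X Y) : nat :=
  match P with
  | Leaf _ => 0
  | ANode _ P0 P1 => (maxn (depth P0) (depth P1)).+1
  | BNode _ P0 P1 => (maxn (depth P0) (depth P1)).+1
  end.

(* Public-coin randomized protocol: a finitely supported probability
   distribution (weights in a real field R) over deterministic protocols.
   (For bounded cost and finite inputs this is no loss of generality.) *)
Definition rproto (R : realFieldType) (X Y : Type) := seq (R * proto X Y).

Definition rcost (R : realFieldType) (X Y : Type) (Q : rproto R X Y) : nat :=
  \max_(e <- Q) depth e.2.

Definition rcorrect (R : realFieldType) (X Y : Type) (f : X -> Y -> bool)
    (Q : rproto R X Y) : Prop :=
  [/\ all (fun e => 0 <= e.1) Q,
      \sum_(e <- Q) e.1 = 1 &
      forall x y, 2%:R / 3%:R <= \sum_(e <- Q | run e.2 x y == f x y) e.1]%R.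

(* Main.v *)
Require Import Defs.
From HB Require Import structures.
From mathcomp Require Import all_boot all_order all_algebra all_fingroup.
From mathcomp Require Import zify lra.

(* The lower bound comes from set disjointness, by Razborov's corruption
   argument. Split a ground set of 2m+1 elements at random into S, {i} and T
   with |S| = |T| = m, and draw a \subset S, b \subset T. The pair (a, b) is
   disjoint and (i |: a, i |: b) meets exactly in i. Let X x Y be a rectangle.
   Given T, the index i is uniform in U = ~: T, and if X has density at least
   2^-d among the subsets of U then all but O(d) indices i in U are balanced:
   X puts a constant fraction of its mass on each side of "i \in a". The same
   holds for Y given S. So, up to an additive 2^-d, the rectangle has at least
   1/128 as much mass on the intersecting pairs as on the disjoint ones, and a
   randomized protocol of cost c, run eight times, forces c = Omega(m).

   Such instances on Omega(n^2) elements embed in a marriage market with n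
   women, in which the couple (w, m) lies in every stable marriage if the sets
   are disjoint, and in none if they share exactly one element. *)

Set Implicit Arguments. Unset Strict Implicit. Unset Printing Implicit Defensive.
Import Order.TTheory GRing.Theory Num.Theory.

(** * A dense family of sets biases few coordinates *)

Section BiasedCoordinates.
Variable E : finType.
Implicit Types (S T U J a b : {set E}) (F : pred {set E}).

(** Each element of [J] contributes a factor 1 + 2 and each other element of [U] a factor 2; the
    extra [2 ^ #|J|] avoids a subtraction in the exponent. *)
Lemma sum_pow2_agree (s : pred E) U J : J \subset U ->
  \sum_(a in powerset U) 2 ^ #|[set j in J | (j \in a) == s j]| * 2 ^ #|J|
    = 2 ^ #|U| * 3 ^ #|J|.
Proof.
move=> JU.
(* [f i] and [g i] are the weights of [i] inside and outside [a]; [f] vanishes off [U], which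
   discards the sets not included in [U] once the product is expanded. *)
pose f i := if i \in U then (if (i \in J) && s i then 2 else 1) else 0.
pose g i := if (i \in J) && ~~ s i then 2 else 1.
have -> : \sum_(a in powerset U) 2 ^ #|[set j in J | (j \in a) == s j]| * 2 ^ #|J|
   = (\prod_i (f i + g i)) * 2 ^ #|J|.
  rewrite -big_distrl /=; congr (_ * _).
  rewrite bigA_distr big_mkcond /=; apply: eq_bigr => a _.
  rewrite powersetE; case: ifPn => [aU | /subsetPn [x xa xU]]; last first.
    by rewrite (bigD1 x) //= xa /f (negbTE xU) mul0n.
  rewrite -sum1_card expn_sum big_mkcond /=; apply: eq_bigr => i _.
  rewrite inE /f /g; case: (boolP (i \in a)) => ia; last by case: (i \in J) (s i) => [] [].
  by rewrite (subsetP aU _ ia); case: (i \in J) (s i) => [] [].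
rewrite -!prod_nat_const [in RHS]big_mkcond [X in _ = _ * X]big_mkcond /=.
rewrite [X in _ * X]big_mkcond -!big_split /=; apply: eq_bigr => i _.
rewrite /f /g; have := subsetP JU i.
by case: (i \in J) => [-> // | _]; case: (s i) (i \in U) => [] [].
Qed.

(* Double counting: on average a member of F disagrees with s on at most 1/8
   of J, so at least half of F agrees with s on 3/4 of J; comparing with the
   total weight [sum_pow2_agree] bounds that half. *)
Lemma card_biased_family F (s : pred E) U J : J \subset U ->
  (forall j, j \in J ->
     8 * #|[set a in powerset U | F a && ((j \in a) != s j)]|
       <= #|[set a in powerset U | F a]|) ->
  #|[set a in powerset U | F a]| ^ 4 * 128 ^ #|J| <= 16 * (2 ^ #|U|) ^ 4 * 81 ^ #|J|.
Proof.
move=> JU rare.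
set A := [set a in powerset U | F a].
pose dis a := #|[set j in J | (j \in a) != s j]|.
pose agr a := #|[set j in J | (j \in a) == s j]|.
have agrE a : agr a + dis a = #|J|.
  rewrite /agr /dis -(cardsID [set j | (j \in a) == s j] J); congr (_ + _);
    by apply: eq_card => j; rewrite !inE // andbC.
have sum_dis : 8 * \sum_(a in A) dis a <= #|A| * #|J|.
  have -> : \sum_(a in A) dis a =
     \sum_(j in J) #|[set a in powerset U | F a && ((j \in a) != s j)]|.
    transitivity (\sum_(a in A) \sum_(j in J | (j \in a) != s j) 1).
      by apply: eq_bigr => a _; rewrite sum1dep_card.
    rewrite (exchange_big_dep (fun j => j \in J)) /=; last by move=> ? ? _ /andP[].
    apply: eq_bigr => j jJ; rewrite -sum1dep_card; apply: eq_bigl => a.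
    by rewrite !inE jJ /= andbA.
  rewrite big_distrr /= mulnC -sum_nat_const; apply: leq_sum => j jJ; exact: rare.
(* Markov's inequality: at most half of [A] disagrees with [s] on more than a quarter of [J]. *)
pose A' := [set a in A | 4 * dis a <= #|J|].
have halfA : #|A| <= 2 * #|A'|.
  case: (posnP #|J|) => J0.
    suff -> : A' = A by lia.
    apply/setP => a; rewrite inE; have -> : 4 * dis a <= #|J| by have := agrE a; lia.
    by rewrite andbT.
  have : \sum_(a in A) dis a >= \sum_(a in A :\: A') dis a.
    rewrite [X in _ <= X](big_setID A') /= ; have -> : A :&: A' = A'.
      by apply/setIidPr/subsetP => a; rewrite inE => /andP[].
    exact: leq_addl.
  have : 4 * \sum_(a in A :\: A') dis a >= #|A :\: A'| * #|J|.
    rewrite big_distrr /= -sum_nat_const; apply: leq_sum => a.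
    by rewrite !inE; case: (_ && F a); rewrite ?andbF //= andbT -ltnNge => /ltnW.
  have : #|A| = #|A'| + #|A :\: A'|.
    rewrite -(cardsID A' A); congr (#|pred_of_set _| + _).
    by apply/setIidPr/subsetP => a; rewrite inE => /andP[].
  move=> cA h1 h2; suff : #|A :\: A'| <= #|A'| by lia.
  rewrite -(leq_pmul2r J0); move: sum_dis; rewrite cA mulnDl; lia.
have wA' : \sum_(a in A') 2 ^ agr a * 2 ^ #|J| <= 2 ^ #|U| * 3 ^ #|J|.
  rewrite -(sum_pow2_agree s JU) [X in _ <= X](big_setID A') /=.
  have -> : powerset U :&: A' = A'.
    by apply/setIidPr/subsetP => a; rewrite !inE => /andP[/andP[]].
  exact: leq_addr.
(* Agreement on 3/4 of [J] gives weight at least 2 to the power 3|J|/4; the fourth power makes this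
   exponent an integer. *)
have lowA' : (#|A'| * 2 ^ #|J|) ^ 4 * 2 ^ (3 * #|J|) <= (2 ^ #|U| * 3 ^ #|J|) ^ 4.
  have [t tJ] : exists t, t * 4 >= 3 * #|J| /\ forall a, a \in A' -> t <= agr a.
    exists ((3 * #|J| + 3) %/ 4); split; first by lia.
    by move=> a; rewrite inE => /andP[_]; have := agrE a; lia.
  case: tJ => tJ tA.
  apply: (@leq_trans ((#|A'| * (2 ^ t * 2 ^ #|J|)) ^ 4)).
    rewrite !expnMn -[X in _ <= _ * (X * _)]expnM mulnA mulnAC leq_mul2r leq_mul2l.
    by rewrite leq_exp2l // tJ !orbT.
  rewrite leq_exp2r //; apply: leq_trans wA'.
  rewrite -sum_nat_const; apply: leq_sum => a aA.
  by rewrite leq_mul2r leq_exp2l // tA ?orbT.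
have -> : 128 ^ #|J| = (2 ^ #|J|) ^ 4 * 2 ^ (3 * #|J|).
  by rewrite -[128]/(2 ^ 7) -!expnM -expnD; congr (2 ^ _); lia.
have -> : 81 ^ #|J| = (3 ^ #|J|) ^ 4 by rewrite -[81]/(3 ^ 4) -!expnM mulnC.
have halfA4 : #|A| ^ 4 <= 16 * #|A'| ^ 4 by rewrite -[16]/(2 ^ 4) -expnMn leq_exp2r.
rewrite -mulnA -expnMn; apply: leq_trans (leq_mul (leqnn 16) lowA').
by rewrite [in X in _ <= X]expnMn -mulnA [X in _ <= X]mulnA leq_mul.
Qed.

(** Density 2^-d turns the previous bound into (128/81)^|J| <= 2^(4d+4). Then 128/81 >= 3/2 and 3^2
    >= 2^3 give the result; the constant 11 comes from odd |J|, where |J|/2 is rounded down. *)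
Lemma few_biased_coordinates F (s : pred E) U J d : J \subset U ->
  (forall j, j \in J ->
     8 * #|[set a in powerset U | F a && ((j \in a) != s j)]|
       <= #|[set a in powerset U | F a]|) ->
  2 ^ #|U| <= 2 ^ d * #|[set a in powerset U | F a]| ->
  #|J| <= 8 * d + 11.
Proof.
move=> JU rare big.
have := card_biased_family JU rare.
move: #|[set a in powerset U | F a]| big => N big h.
have {}h : 128 ^ #|J| <= 2 ^ (4 * d + 4) * 81 ^ #|J|.
  have u0 : 0 < (2 ^ #|U|) ^ 4 by rewrite !expn_gt0.
  rewrite -(leq_pmul2l u0).
  apply: leq_trans (_ : (2 ^ d * N) ^ 4 * 128 ^ #|J| <= _).
    by rewrite leq_mul2r leq_exp2r // big orbT.
  rewrite expnMn -mulnA; apply: leq_trans (_ : (2 ^ d) ^ 4 * (16 * (2 ^ #|U|) ^ 4 * 81 ^ #|J|) <= _).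
    by rewrite leq_mul2l h orbT.
  by rewrite expnD [4 * d]mulnC expnM -[2 ^ 4]/16; move: (_ ^ 4) (_ ^ 4) (81 ^ _) => x y z; nia.
have {}h : 3 ^ #|J| <= 2 ^ (#|J| + (4 * d + 4)).
  have c : (81 * 3) ^ #|J| <= (128 * 2) ^ #|J|.
    by case: #|J| => // k; rewrite leq_exp2r.
  rewrite -(leq_pmul2l (m := 81 ^ #|J|)) ?expn_gt0 // -expnMn.
  apply: leq_trans c _; rewrite expnMn expnD mulnCA mulnC leq_mul2l mulnC.
  by rewrite h orbT.
have : 2 ^ (3 * (#|J| %/ 2)) <= 3 ^ #|J|.
  rewrite {2}(divn_eq #|J| 2) expnD [_ %/ 2 * 2]mulnC !expnM.
  apply: leq_trans (_ : (3 ^ 2) ^ (#|J| %/ 2) <= _).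
    by case: (_ %/ 2) => // k; rewrite leq_exp2r.
  by rewrite leq_pmulr // expn_gt0.
move=> h2; move: (leq_trans h2 h); rewrite leq_exp2l //; lia.
Qed.

End BiasedCoordinates.

(** * The corruption bound for set disjointness *)

Section Corruption.
Variable E : finType.
Implicit Types (S T U J a b : {set E}) (F X Y : pred {set E}).

(** For a rectangle, products of [count0] count disjoint pairs, and products of [count1] count the
    pairs obtained by adding [i] to both sets. *)
Definition count0 F S := #|[set a in powerset S | F a]|.
Definition count1 F S i := #|[set a in powerset S | F (i |: a)]|.

Lemma count0_le F S : count0 F S <= 2 ^ #|S|.
Proof.
rewrite -card_powerset; apply/subset_leq_card/subsetP => a.
by rewrite inE => /andP[].
Qed.

Lemma card_family_notin F U i :
  #|[set a in powerset U | F a && (i \notin a)]| = count0 F (U :\ i).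
Proof.
apply: eq_card => a; rewrite !inE subsetD1; case: (a \subset U) => //=.
by rewrite andbC.
Qed.

Lemma card_family_in F U i : i \in U ->
  #|[set a in powerset U | F a && (i \in a)]| = count1 F (U :\ i) i.
Proof.
move=> iU; rewrite /count1 -(card_in_imset (f := fun a => a :\ i)); last first.
  move=> a b; rewrite !inE => /andP[_ /andP[_ ia]] /andP[_ /andP[_ ib]] eq_ab.
  by rewrite -(setD1K ia) eq_ab setD1K.
apply: eq_card => b; apply/imsetP/idP => [[a]|].
  rewrite !inE => /andP[aU /andP[Fa ia]] ->; rewrite setD1K // Fa andbT.
  exact: setSD.
rewrite !inE subsetD1 => /andP[/andP[bU ib] Fb]; exists (i |: b).
  by rewrite !inE Fb eqxx subUset sub1set iU bU.
by rewrite setU1K.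
Qed.

Lemma count0_split F U i : i \in U ->
  count0 F U = count0 F (U :\ i) + count1 F (U :\ i) i.
Proof.
move=> iU; rewrite -card_family_in // -card_family_notin /count0 addnC.
rewrite -(cardsID [set a : {set E} | i \in a] [set a in powerset U | F a]).
by congr (_ + _); apply: eq_card => a; rewrite !inE -?andbA //= [in RHS]andbA andbC.
Qed.

(** For [i] in [U], the members of [F] inside [U] split into those with [i] ([count1]) and those
    without ([count0]); one of the two sides holds less than 1/8 of them. *)
Definition biased F U i :=
  (8 * count1 F (U :\ i) i < count0 F U) || (8 * count0 F (U :\ i) < count0 F U).

Lemma card_biased_le F U d : 2 ^ #|U| <= 2 ^ d * count0 F U ->
  #|[set i in U | biased F U i]| <= 8 * d + 11.
Proof.
(* The side preferred by a biased [i]: true when the members omitting [i] are the rare ones. *)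
pose s i := ~~ (8 * count1 F (U :\ i) i < count0 F U).
apply: (@few_biased_coordinates _ F s); first by apply/subsetP => i; rewrite inE => /andP[].
move=> j; rewrite inE => /andP[jU bj].
have -> : #|[set a in powerset U | F a && ((j \in a) != s j)]| =
   if s j then count0 F (U :\ j) else count1 F (U :\ j) j.
  case: (s j); rewrite -?card_family_in -?card_family_notin //; apply: eq_card => a;
    by rewrite !inE; case: (j \in a).
move: bj; rewrite /biased /s; case: (boolP (_ < _)) => /= [/ltnW // | _ /ltnW //].
Qed.

(** If [F] has density at least 2^-d in [U], an unbiased index contributes at least 1/8 of
    [count0 F U], a biased one at most all of it, and the factor 33 makes the unbiased ones 32 times
    as many. Otherwise the additive term covers the whole sum. *)
Lemma sum_biased_le F U m d : #|U| = m.+1 -> 33 * (8 * d + 11) <= m.+1 ->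
  4 * 2 ^ d * \sum_(i in U | biased F U i) count0 F (U :\ i)
    <= 2 ^ d * \sum_(i in U) count0 F (U :\ i) + 8 * m.+1 * 2 ^ m.
Proof.
move=> cU dm; set N := count0 F U; set J := [set i in U | biased F U i].
have JU : J \subset U by apply/subsetP => i; rewrite inE => /andP[].
have eJ : \sum_(i in U | biased F U i) count0 F (U :\ i) =
          \sum_(i in J) count0 F (U :\ i).
  by apply: eq_bigl => i; rewrite inE.
have leJ : \sum_(i in J) count0 F (U :\ i) <= #|J| * N.
  rewrite -sum_nat_const; apply: leq_sum => i /(subsetP JU) iU.
  by rewrite /N (count0_split F iU) leq_addr.
rewrite eJ; case: (leqP (2 ^ m.+1) (2 ^ d * N)) => hN.
  have cJ : #|J| <= 8 * d + 11 by apply: card_biased_le; rewrite cU.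
  have good : 8 * \sum_(i in U) count0 F (U :\ i) >= (m.+1 - #|J|) * N.
    rewrite -cU -cardsDS // -sum_nat_const [X in _ <= 8 * X](big_setID J) /= mulnDr.
    apply: leq_trans (leq_addl _ _); rewrite big_distrr /=; apply: leq_sum => i.
    rewrite inE => /andP[iJ iU]; move: iJ; rewrite inE iU /= /biased negb_or.
    by case/andP=> _; rewrite -leqNgt.
  have : 32 * #|J| * N <= (m.+1 - #|J|) * N by rewrite leq_mul2r; apply/orP; right; lia.
  move: (2 ^ d) (2 ^ m) => x y h; nia.
have : #|J| <= m.+1 by rewrite -cU subset_leq_card.
move: hN; rewrite expnS.
move: (2 ^ d) (2 ^ m) leJ => x y leJ hN hJ.
apply: leq_trans (_ : 4 * x * (m.+1 * N) <= _).
  by rewrite leq_mul2l (leq_trans leJ) ?orbT // leq_mul2r hJ orbT.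
apply: leq_trans (leq_addl _ _).
nia.
Qed.

(* A configuration (T, i, a, b) encodes the partition of E into T, {i} and the
   set S of remaining elements, together with a \subset S and b \subset T.
   The disjoint pair is (a, b), the uniquely intersecting one is
   (i |: a, i |: b). *)
Definition partition_pair (m : nat) (p : {set E} * E) :=
  (#|p.1| == m) && (p.2 \notin p.1).
Definition other_part (p : {set E} * E) := ~: p.1 :\ p.2.
Definition config (m : nat) (z : ({set E} * E) * ({set E} * {set E})) :=
  partition_pair m z.1 && ((z.2.1 \in powerset (other_part z.1)) && (z.2.2 \in powerset z.1.1)).

(** The symmetry between the players: it exchanges S and T, so that a bound on Alice's side also
    serves Bob's. *)
Definition swap_parts (p : {set E} * E) := (other_part p, p.2).

Lemma swap_partsK m p : partition_pair m p -> swap_parts (swap_parts p) = p.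
Proof.
case: p => T i /andP[_ /= iT]; rewrite /swap_parts /other_part /=; congr (_, _).
apply/setP => x; rewrite !inE; case: eqVneq => [-> | _] /=; last by rewrite negbK.
by rewrite (negbTE iT).
Qed.

Lemma swap_parts_pair m p : #|E| = m.*2.+1 ->
  partition_pair m p -> partition_pair m (swap_parts p).
Proof.
case: p => T i cE /andP[/= /eqP cT iT]; rewrite /partition_pair /swap_parts /other_part /=.
rewrite !inE eqxx andbT /=; have := cardsC T; have := cardsD1 i (~: T).
by rewrite inE iT cE cT => -> /=; lia.
Qed.

Lemma sum_swap_parts m (G : {set E} -> {set E} -> E -> nat) : #|E| = m.*2.+1 ->
  \sum_(p | partition_pair m p) G (other_part p) p.1 p.2 =
  \sum_(p | partition_pair m p) G p.1 (other_part p) p.2.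
Proof.
move=> cE; rewrite (reindex_onto swap_parts swap_parts) /=; last exact: swap_partsK.
apply: eq_big => [p | p].
  apply/andP/idP => [[pp /eqP <-] | pp]; first exact: swap_parts_pair.
  by rewrite swap_parts_pair // (swap_partsK pp).
by case/andP=> _ /eqP /(congr1 fst) /= ->.
Qed.

(** Once T and i are fixed, a and b range independently over the subsets of S and of T, so the count
    factors. *)
Lemma card_config_rect m X Y :
  #|[set z | config m z && (X z.2.1 && Y z.2.2)]| =
  \sum_(p | partition_pair m p) count0 X (other_part p) * count0 Y p.1.
Proof.
rewrite -sum1dep_card.
rewrite (eq_bigl (fun z => partition_pair m z.1 &&
   (((z.2.1 \in powerset (other_part z.1)) && X z.2.1) && ((z.2.2 \in powerset z.1.1) && Y z.2.2)))).
  rewrite -(pair_big_dep (partition_pair m) (fun p (c : {set E} * {set E}) =>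
    ((c.1 \in powerset (other_part p)) && X c.1) && ((c.2 \in powerset p.1) && Y c.2)) (fun _ _ => 1)) /=.
  apply: eq_bigr => p _.
  rewrite -(pair_big_dep (fun a => (a \in powerset (other_part p)) && X a)
              (fun _ b => (b \in powerset p.1) && Y b) (fun _ _ => 1)) /=.
  under eq_bigr do rewrite sum1dep_card.
  by rewrite sum_nat_cond_const.
by move=> z; rewrite /config -andbA [X in _ && X]andbACA.
Qed.

Lemma card_config_rect1 m X Y :
  #|[set z | config m z && (X (z.1.2 |: z.2.1) && Y (z.1.2 |: z.2.2))]| =
  \sum_(p | partition_pair m p) count1 X (other_part p) p.2 * count1 Y p.1 p.2.
Proof.
rewrite -sum1dep_card.
rewrite (eq_bigl (fun z => partition_pair m z.1 &&
   (((z.2.1 \in powerset (other_part z.1)) && X (z.1.2 |: z.2.1)) &&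
    ((z.2.2 \in powerset z.1.1) && Y (z.1.2 |: z.2.2))))).
  rewrite -(pair_big_dep (partition_pair m) (fun p (c : {set E} * {set E}) =>
    ((c.1 \in powerset (other_part p)) && X (p.2 |: c.1)) &&
    ((c.2 \in powerset p.1) && Y (p.2 |: c.2))) (fun _ _ => 1)) /=.
  apply: eq_bigr => p _.
  rewrite -(pair_big_dep (fun a => (a \in powerset (other_part p)) && X (p.2 |: a))
              (fun _ b => (b \in powerset p.1) && Y (p.2 |: b)) (fun _ _ => 1)) /=.
  under eq_bigr do rewrite sum1dep_card.
  by rewrite sum_nat_cond_const.
by move=> z; rewrite /config -andbA [X in _ && X]andbACA.
Qed.

Lemma sum_partition_pair m (G : {set E} -> E -> nat) :
  \sum_(p | partition_pair m p) G p.1 p.2 =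
  \sum_(T : {set E} | #|T| == m) \sum_(i in ~: T) G T i.
Proof.
rewrite -(pair_big_dep (fun T : {set E} => #|T| == m) (fun T i => i \notin T) G) /=.
by apply: eq_bigr => T _; apply: eq_bigl => i; rewrite inE.
Qed.

Lemma card_config m : #|E| = m.*2.+1 ->
  #|[set z | config m z]| = (\sum_(p | partition_pair m p) 1) * (2 ^ m * 2 ^ m).
Proof.
move=> cE; have := card_config_rect m predT predT.
rewrite (_ : [set z | _ && (_ && _)] = [set z | config m z]); last first.
  by apply/setP => z; rewrite [LHS]inE [RHS]inE [X in _ && X]/= andbT.
move=> ->; rewrite big_distrl /=; apply: eq_bigr => p pp; rewrite mul1n.
have c0 S : count0 predT S = 2 ^ #|S|.
  by rewrite /count0 -card_powerset; apply: eq_card => a; rewrite !inE andbT.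
rewrite !c0; have /andP[/eqP -> _] := pp.
by have /andP[/= /eqP -> _] := swap_parts_pair cE pp.
Qed.

(** With T fixed, Bob's factor [count0 Y T] does not depend on i, so [sum_biased_le] applies to [X]
    on the complement of T. *)
Lemma sum_biased_config m d X Y : #|E| = m.*2.+1 -> 33 * (8 * d + 11) <= m.+1 ->
  4 * 2 ^ d * \sum_(p | partition_pair m p && biased X (~: p.1) p.2)
       count0 X (other_part p) * count0 Y p.1
  <= 2 ^ d * (\sum_(p | partition_pair m p) count0 X (other_part p) * count0 Y p.1)
     + 8 * #|[set z | config m z]|.
Proof.
move=> cE dm; rewrite card_config // big_mkcondr /=.
rewrite (sum_partition_pair m (fun T i => if biased X (~: T) i then count0 X (~: T :\ i) * count0 Y T else 0)).
rewrite (sum_partition_pair m (fun T i => count0 X (~: T :\ i) * count0 Y T)).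
rewrite (sum_partition_pair m (fun _ _ => 1)).
rewrite big_distrr [X in _ <= X + _]big_distrr /= big_distrl /= [X in _ <= _ + X]big_distrr /=.
rewrite -big_split /=; apply: leq_sum => T /eqP cT.
have cU : #|~: T| = m.+1 by have := cardsC T; lia.
rewrite -big_mkcondr /= -!big_distrl /= sum1_card cU.
have := sum_biased_le X cU dm; have : count0 Y T <= 2 ^ m by rewrite -cT count0_le.
move: (\sum_(i in ~: T | _) _) (\sum_(i in ~: T) _) (count0 Y T) (2 ^ d) (2 ^ m).
move=> s1 s2 c x y cy h.
rewrite !mulnA; apply: leq_trans (leq_mul h (leqnn c)) _.
by rewrite mulnDl leq_add2l -!mulnA !leq_mul.
Qed.

(** Where neither side is biased, passing from [count0] to [count1] loses a factor 8 per player,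
    hence 64. The biased configurations take at most a quarter of the disjoint mass per player, up
    to the additive term; absorbing that half doubles 64 to 128. *)
Lemma corruption_disj m d X Y : #|E| = m.*2.+1 -> 33 * (8 * d + 11) <= m.+1 ->
  2 ^ d * #|[set z | config m z && (X z.2.1 && Y z.2.2)]|
   <= 128 * 2 ^ d * #|[set z | config m z && (X (z.1.2 |: z.2.1) && Y (z.1.2 |: z.2.2))]|
      + 8 * #|[set z | config m z]|.
Proof.
move=> cE dm; rewrite card_config_rect card_config_rect1.
have hX := sum_biased_config X Y cE dm.
have := sum_biased_config Y X cE dm.
have eqU p : ~: other_part p = p.2 |: p.1.
  by apply/setP => x; rewrite !inE negb_and !negbK.
rewrite big_mkcondr /=.
(* Bob's estimate was obtained with the roles of S and T exchanged; this brings it back to the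
   indexing of Alice's. *)
rewrite -(sum_swap_parts (fun S T i => if biased Y (~: S) i then count0 Y T * count0 X S else 0)) //.
rewrite -(sum_swap_parts (fun S T i => count0 Y T * count0 X S)) //.
set sY := \sum_(p | _) (if _ then _ else _).
set D' := \sum_(p | partition_pair m p) count0 Y p.1 * count0 X (other_part p) => hY.
move: hX; set sX := \sum_(p | _ && _) _; set D := \sum_(p | _) _ => hX.
have eD : D' = D by apply: eq_bigr => p _; rewrite mulnC.
rewrite eD in hY; set I := \sum_(p | _) (count1 _ _ _ * _).
suff : D <= sX + sY + 64 * I.
  move: (2 ^ d) #|_| hX hY => x y hX hY hD.
  have : 4 * x * D <= 4 * x * (sX + sY + 64 * I) by rewrite leq_mul2l hD orbT.
  nia.
rewrite /sX big_mkcondr /= /D /sY /I big_distrr -!big_split /=.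
apply: leq_sum => p pp; rewrite eqU.
have /andP[_ ip] := pp.
have i1 : p.2 \in ~: p.1 by rewrite inE.
have i2 : p.2 \in p.2 |: p.1 by rewrite setU11.
have e2 : (p.2 |: p.1) :\ p.2 = p.1 by rewrite setU1K.
rewrite {1}/biased {1}/biased e2 -/(other_part p).
case: ifPn => [_ | ]; first by rewrite -addnA leq_addr.
rewrite negb_or -!leqNgt => /andP[h1 _].
case: ifPn => [_ | ]; first by rewrite mulnC add0n leq_addr.
rewrite negb_or -!leqNgt => /andP[h2 _]; rewrite !add0n.
have h3 : count0 X (other_part p) <= 8 * count1 X (other_part p) p.2.
  by apply: leq_trans h1; rewrite (count0_split X i1) leq_addr.
have h4 : count0 Y p.1 <= 8 * count1 Y p.1 p.2.
  by apply: leq_trans h2; rewrite (count0_split Y i2) e2 leq_addr.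
by apply: leq_trans (leq_mul h3 h4) _; rewrite mulnACA.
Qed.

End Corruption.

(** * Maxima and sums over sequences *)

Lemma bigmax_seq_leq (T : Type) (s : seq T) (F : T -> nat) m :
  (\max_(x <- s) F x <= m) = all (fun x => F x <= m) s.
Proof. by elim: s => [|x s IH]; rewrite ?big_nil // big_cons geq_max IH. Qed.

Lemma all_bigmax_seq (T : Type) (s : seq T) (F : T -> nat) :
  all (fun x => F x <= \max_(y <- s) F y) s.
Proof. by rewrite -bigmax_seq_leq. Qed.

Lemma all_allpairs_intro (S T U : Type) (f : S -> T -> U) s t
    (a : pred S) (b : pred T) (c : pred U) :
  (forall x y, a x -> b y -> c (f x y)) -> all a s -> all b t ->
  all c [seq f x y | x <- s, y <- t].
Proof.
move=> abc; elim: s => //= x s IH /andP[ax a_s] bt; rewrite all_cat IH // andbT all_map.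
by apply: sub_all bt => y; exact: abc.
Qed.

Lemma ler_sum_all (R : realFieldType) (T : Type) (s : seq T) (a : pred T) (F G : T -> R) :
  (forall x, a x -> F x <= G x)%R -> all a s -> (\sum_(x <- s) F x <= \sum_(x <- s) G x)%R.
Proof.
move=> FG; elim: s => [|x s IH]; first by rewrite !big_nil.
by case/andP=> ax a_s; rewrite !big_cons lerD ?FG ?IH.
Qed.

(** * Independent repetition of randomized protocols *)

Section Protocols.
Variables (X Y : Type).
Implicit Types (P : proto X Y).

Fixpoint proto_and P1 P2 : proto X Y :=
  match P1 with
  | Leaf b => if b then P2 else Leaf X Y false
  | ANode f P Q => ANode f (proto_and P P2) (proto_and Q P2)
  | BNode g P Q => BNode g (proto_and P P2) (proto_and Q P2)
  end.

Lemma run_proto_and P1 P2 x y : run (proto_and P1 P2) x y = run P1 x y && run P2 x y.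
Proof.
elim: P1 => [[] | f P IHP Q IHQ | g P IHP Q IHQ] //=; first by case: (f x).
by case: (g y).
Qed.

Lemma depth_proto_and P1 P2 : depth (proto_and P1 P2) <= depth P1 + depth P2.
Proof.
by elim: P1 => [[] | f P IHP Q IHQ | g P IHP Q IHQ] //=; lia.
Qed.

Section Randomized.
Variable R : realFieldType.
Implicit Types (Q : rproto R X Y).
Local Open Scope ring_scope.

Definition rdist Q := all (fun e => 0 <= e.1) Q && (\sum_(e <- Q) e.1 == 1).

Definition accept Q x y := \sum_(e <- Q | run e.2 x y) e.1.

(** The product distribution models two independent runs: acceptance probabilities multiply and
    costs add. *)
Definition rproto_and Q1 Q2 : rproto R X Y :=
  [seq (e1.1 * e2.1, proto_and e1.2 e2.2) | e1 <- Q1, e2 <- Q2].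

Lemma accept_rproto_and Q1 Q2 x y :
  accept (rproto_and Q1 Q2) x y = accept Q1 x y * accept Q2 x y.
Proof.
rewrite /accept big_mkcond /= /rproto_and big_allpairs_dep /=.
rewrite [X in _ = X * _]big_mkcond [X in _ = _ * X]big_mkcond /= big_distrlr /=.
apply: eq_bigr => e1 _; apply: eq_bigr => e2 _.
by rewrite run_proto_and; case: run; case: run; rewrite ?mulr0 ?mul0r.
Qed.

Lemma rdist_rproto_and Q1 Q2 : rdist Q1 -> rdist Q2 -> rdist (rproto_and Q1 Q2).
Proof.
move=> /andP[nn1 /eqP s1] /andP[nn2 /eqP s2]; apply/andP; split.
  by apply: all_allpairs_intro nn1 nn2 => e1 e2 /=; exact: mulr_ge0.
rewrite /rproto_and big_allpairs_dep /=.
under eq_bigr do rewrite -big_distrr s2 /= mulr1.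
by rewrite s1.
Qed.

Lemma rcost_rproto_and Q1 Q2 : (rcost (rproto_and Q1 Q2) <= rcost Q1 + rcost Q2)%N.
Proof.
rewrite /rcost bigmax_seq_leq; set F := fun e : R * proto X Y => depth e.2.
apply: all_allpairs_intro (all_bigmax_seq Q1 F) (all_bigmax_seq Q2 F) => e1 e2 h1 h2 /=.
exact: leq_trans (depth_proto_and _ _) (leq_add h1 h2).
Qed.

Fixpoint rproto_pow t Q : rproto R X Y :=
  if t is t'.+1 then rproto_and Q (rproto_pow t' Q) else [:: (1, Leaf X Y true)].

Lemma accept_rproto_pow t Q x y : accept (rproto_pow t Q) x y = accept Q x y ^+ t.
Proof.
elim: t => [|t IH] /=; first by rewrite /accept big_cons big_nil /= addr0 expr0.
by rewrite accept_rproto_and IH exprS.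
Qed.

Lemma rdist_rproto_pow t Q : rdist Q -> rdist (rproto_pow t Q).
Proof.
move=> dQ; elim: t => [|t IH] /=; last exact: rdist_rproto_and.
by rewrite /rdist /= ler01 big_cons big_nil addr0 eqxx.
Qed.

Lemma rcost_rproto_pow t Q : (rcost (rproto_pow t Q) <= t * rcost Q)%N.
Proof.
elim: t => [|t IH] /=; first by rewrite /rcost big_cons big_nil.
by apply: leq_trans (rcost_rproto_and _ _) _; rewrite mulSn leq_add2l.
Qed.

End Randomized.

(** * From rectangles to protocols *)

Section RectangleBound.
Variables (Z : finType) (V : {set Z}) (x0 x1 : Z -> X) (y0 y1 : Z -> Y).
Variables (c k e : nat).
Hypothesis rectangle_bound : forall (A : pred X) (B : pred Y),
  c * #|[set z in V | A (x0 z) && B (y0 z)]|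
    <= k * #|[set z in V | A (x1 z) && B (y1 z)]| + e.

(** A node of Alice cuts [A] in two and a node of Bob cuts [B], so every leaf sees a rectangle. Each
    of the at most [2 ^ depth P] accepting leaves costs one additive [e]. *)
Lemma proto_rectangle_bound P (A : pred X) (B : pred Y) :
  c * #|[set z in V | (A (x0 z) && B (y0 z)) && run P (x0 z) (y0 z)]|
    <= k * #|[set z in V | (A (x1 z) && B (y1 z)) && run P (x1 z) (y1 z)]|
       + 2 ^ depth P * e.
Proof.
have split_card (C0 C1 C : pred Z) : (forall z, C z = C0 z || C1 z) ->
    (forall z, C0 z -> C1 z -> false) ->
    #|[set z in V | C z]| = #|[set z in V | C0 z]| + #|[set z in V | C1 z]|.
  move=> CE dis; rewrite -cardsUI (_ : _ :&: _ = set0) ?cards0 ?addn0.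
    by apply: eq_card => z; rewrite !inE CE andb_orr.
  apply/setP => z; rewrite !inE; apply/negP => /andP[/andP[_ h0] /andP[_ h1]].
  by have := dis _ h0 h1.
elim: P A B => [b | f P0 IH0 P1 IH1 | g P0 IH0 P1 IH1] A B.
- case: b; last by rewrite (_ : [set z in V | _] = set0) ?cards0 ?muln0 //; apply/setP => z; rewrite !inE andbF /= andbF.
  have drop x y : #|[set z in V | (A (x z) && B (y z)) && true]| =
      #|[set z in V | A (x z) && B (y z)]|.
    by apply: eq_card => z; rewrite !inE andbT.
  by rewrite /= !drop expn0 mul1n.
- have spl x y : #|[set z in V | (A (x z) && B (y z)) && run (ANode f P0 P1) (x z) (y z)]| =
     #|[set z in V | (predI A (predC f) (x z) && B (y z)) && run P0 (x z) (y z)]| +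
     #|[set z in V | (predI A f (x z) && B (y z)) && run P1 (x z) (y z)]|.
    apply: split_card => z /=; first by case: (A _) (f _) (B _) => [] [] [] /=; rewrite ?orbF.
    by case: (A _) (f _) (B _) => [] [] [].
  rewrite !spl !mulnDr.
  apply: leq_trans (leq_add (IH0 (predI A (predC f)) B) (IH1 (predI A f) B)) _.
  rewrite addnACA leq_add2l -mulnDl leq_mul2r expnS mul2n -addnn.
  by rewrite leq_add ?orbT // leq_exp2l // ?leq_maxl ?leq_maxr.
- have spl x y : #|[set z in V | (A (x z) && B (y z)) && run (BNode g P0 P1) (x z) (y z)]| =
     #|[set z in V | (A (x z) && predI B (predC g) (y z)) && run P0 (x z) (y z)]| +
     #|[set z in V | (A (x z) && predI B g (y z)) && run P1 (x z) (y z)]|.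
    apply: split_card => z /=; first by case: (A _) (g _) (B _) => [] [] [] /=; rewrite ?orbF.
    by case: (A _) (g _) (B _) => [] [] [].
  rewrite !spl !mulnDr.
  apply: leq_trans (leq_add (IH0 A (predI B (predC g))) (IH1 A (predI B g))) _.
  rewrite addnACA leq_add2l -mulnDl leq_mul2r expnS mul2n -addnn.
  by rewrite leq_add ?orbT // leq_exp2l // ?leq_maxl ?leq_maxr.
Qed.

Local Open Scope ring_scope.

Lemma sum_accept (R : realFieldType) (Q : rproto R X Y) (x : Z -> X) (y : Z -> Y) :
  \sum_(z in V) accept Q (x z) (y z) =
  \sum_(q <- Q) q.1 * #|[set z in V | run q.2 (x z) (y z)]|%:R.
Proof.
rewrite /accept (exchange_big_dep xpredT) //=; apply: eq_bigr => q _.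
by rewrite -sum1dep_card natr_sum mulr_sumr; apply: eq_bigr => z _; rewrite mulr1.
Qed.

Lemma rproto_rectangle_bound (R : realFieldType) (Q : rproto R X Y) : rdist Q ->
  c%:R * \sum_(z in V) accept Q (x0 z) (y0 z)
    <= k%:R * \sum_(z in V) accept Q (x1 z) (y1 z) + (2 ^ rcost Q * e)%:R :> R.
Proof.
move=> /andP[nn /eqP s1]; rewrite !sum_accept.
rewrite -[X in _ <= _ + X]mul1r -[X in _ <= _ + X * _]s1.
rewrite mulr_suml !mulr_sumr -big_split /=.
have good : all (fun q => (0 <= q.1) && (depth q.2 <= rcost Q)%N) Q.
  by rewrite all_predI nn; exact: (all_bigmax_seq Q (fun q => depth q.2)).
apply: ler_sum_all good => q /andP[q0 qd].
rewrite !(mulrCA _ q.1) -mulrDr ler_wpM2l // -!natrM -natrD ler_nat.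
apply: leq_trans (_ : _ <= k * #|[set z in V | run q.2 (x1 z) (y1 z)]| + 2 ^ depth q.2 * e)%N _.
  exact: (proto_rectangle_bound q.2 predT predT).
by rewrite leq_add2l leq_mul2r leq_exp2l // qd orbT.
Qed.

End RectangleBound.

Local Open Scope ring_scope.

(* Running Q eight times and accepting when every run accepts raises the ratio
   of the acceptance probabilities from 2 to 2^8, above the factor 128. *)
Lemma rcost_lower_bound (Z : finType) (V : {set Z}) (x0 x1 : Z -> X) (y0 y1 : Z -> Y)
    (d : nat) (R : realFieldType) (Q : rproto R X Y) (f : X -> Y -> bool) :
  (0 < #|V|)%N ->
  (forall (A : pred X) (B : pred Y),
    2 ^ d * #|[set z in V | A (x0 z) && B (y0 z)]|
     <= 128 * 2 ^ d * #|[set z in V | A (x1 z) && B (y1 z)]| + 8 * #|V|)%N ->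
  rcorrect f Q ->
  (forall z, z \in V -> f (x0 z) (y0 z)) ->
  (forall z, z \in V -> ~~ f (x1 z) (y1 z)) ->
  (d <= 8 * rcost Q + 9)%N.
Proof.
move=> V0 rect [nn s1 corr] f0 f1.
have dQ : rdist Q by rewrite /rdist nn s1 eqxx.
have acc0 z : z \in V -> 2%:R / 3%:R <= accept Q (x0 z) (y0 z).
  move=> zV; have := corr (x0 z) (y0 z); rewrite f0 //.
  by rewrite (eq_bigl (fun e => run e.2 (x0 z) (y0 z))) // => e; rewrite eqb_id.
have acc1 z : z \in V -> 0 <= accept Q (x1 z) (y1 z) <= 1 / 3%:R.
  move=> zV; have := corr (x1 z) (y1 z); rewrite (negbTE (f1 _ zV)).
  rewrite (eq_bigl (fun e => ~~ run e.2 (x1 z) (y1 z))); last by move=> e; rewrite eqbF_neg.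
  move=> h; apply/andP; split.
    rewrite /accept big_mkcond -[X in X <= _](@big1_eq _ 0 +%R _ Q xpredT).
    by apply: ler_sum_all nn => e e0; case: ifP.
  have := s1; rewrite (bigID (fun e => run e.2 (x1 z) (y1 z))) /= -/(accept Q _ _).
  by move: h; lra.
have := rproto_rectangle_bound rect (rdist_rproto_pow 8 dQ).
have le0 : (2%:R / 3%:R) ^+ 8 * #|V|%:R <=
    \sum_(z in V) accept (rproto_pow 8 Q) (x0 z) (y0 z).
  rewrite mulr_natr -sumr_const; apply: ler_sum => z zV.
  have a0 := acc0 _ zV; have b0 : 0 <= 2%:R / 3%:R :> R by rewrite divr_ge0.
  by rewrite accept_rproto_pow lerXn2r ?nnegrE // (le_trans b0).
have le1 : \sum_(z in V) accept (rproto_pow 8 Q) (x1 z) (y1 z) <=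
    (1 / 3%:R) ^+ 8 * #|V|%:R.
  rewrite mulr_natr -sumr_const; apply: ler_sum => z zV.
  have /andP[h1 h2] := acc1 _ zV.
  by rewrite accept_rproto_pow lerXn2r ?nnegrE // divr_ge0.
have lec : (2 ^ rcost (rproto_pow 8 Q) * (8 * #|V|))%:R <= (2 ^ (8 * rcost Q) * (8 * #|V|))%:R :> R.
  by rewrite ler_nat leq_mul2r leq_exp2l // rcost_rproto_pow orbT.
move=> h.
have {h lec le0 le1} : (2 ^ d)%:R * ((2%:R / 3%:R) ^+ 8 * #|V|%:R) <=
  (128 * 2 ^ d)%:R * ((1 / 3%:R) ^+ 8 * #|V|%:R) + (2 ^ (8 * rcost Q) * (8 * #|V|))%:R :> R.
  apply: le_trans (_ : _ <= (2 ^ d)%:R * \sum_(z in V) accept (rproto_pow 8 Q) (x0 z) (y0 z)) _.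
    by rewrite ler_wpM2l.
  apply: le_trans h _; apply: lerD => //.
  by rewrite ler_wpM2l.
have V0R : 0 < #|V|%:R :> R by rewrite ltr0n.
rewrite !natrM mulrA (mulrA _ (_ ^+ 8)) (mulrA _ 8%:R) -mulrDl ler_pM2r //.
set u := (2 ^ d)%:R; set v := (2 ^ (8 * _))%:R => h.
(* Multiplying by 3^8 = 6561 leaves (2^8 - 128) u <= 8 * 6561 v. *)
have : 16%:R * u <= 6561%:R * v by move: h; rewrite !exprS expr0; lra.
rewrite -!natrM ler_nat => h2.
(* Here 6561 is rounded up to 2^13, whence the constant 9 = 13 - 4. *)
have : (2 ^ (d + 4) <= 2 ^ (8 * rcost Q + 13))%N.
  rewrite (expnD _ d) (expnD _ (8 * _)) -[(2 ^ 4)%N]/16%N mulnC; apply: leq_trans h2 _.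
  by rewrite [X in (X <= _)%N]mulnC leq_mul.
by rewrite leq_exp2l //; lia.
Qed.

End Protocols.

(** * Preference orders from numerical keys *)

Section RankOfKey.
Variables (n : nat) (key : 'I_n -> nat).

(** Lexicographic order: ties between keys are broken by the index, which is below [n]. *)
Let ikey (x : 'I_n) := key x * n + x.

Lemma ikey_lt x y : key x < key y -> ikey x < ikey y.
Proof. rewrite /ikey; have := ltn_ord x; have := ltn_ord y; nia. Qed.

Lemma ikey_inj : injective ikey.
Proof.
move=> x y; case: (ltngtP (key x) (key y)) => [/ikey_lt|/ikey_lt|]; try lia.
by rewrite /ikey => -> /addnI /val_inj.
Qed.

Lemma rank_subproof x : #|[set y | ikey y < ikey x]| < n.
Proof.
rewrite -[X in _ < X]card_ord -cardsT; apply: proper_card; apply/properP; split.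
  exact: subsetT.
by exists x; rewrite !inE // ltnn.
Qed.

Definition rank (x : 'I_n) : 'I_n := Ordinal (rank_subproof x).

Lemma rank_lt_ikey x y : ikey x < ikey y -> rank x < rank y.
Proof.
move=> xy; apply: proper_card; apply/properP; split.
  by apply/subsetP => z; rewrite !inE => /ltn_trans; apply.
by exists x; rewrite !inE ?xy ?ltnn.
Qed.

Lemma rank_inj : injective rank.
Proof.
move=> x y exy; apply: ikey_inj; case: (ltngtP (ikey x) (ikey y)) => // /rank_lt_ikey;
  by rewrite exy ltnn.
Qed.

Definition rank_perm : {perm 'I_n} := perm rank_inj.

Lemma rank_perm_lt x y : key x < key y -> rank_perm x < rank_perm y.
Proof. by move=> /ikey_lt /rank_lt_ikey; rewrite !permE. Qed.

(** Only a weak inequality, because of ties; stability is therefore checked below against weak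
    preferences in the keys. *)
Lemma rank_perm_le x y : rank_perm x < rank_perm y -> key x <= key y.
Proof. by move=> rxy; rewrite leqNgt; apply/negP => /rank_perm_lt; lia. Qed.

End RankOfKey.

(** * Invariance under renaming the men *)

Section RelabelMen.
Variables (n : nat) (s : {perm 'I_n}).
Local Open Scope group_scope.

(** Products of permutations apply the left factor first, so each woman ranks [s j] as she ranked
    [j]. *)
Definition relabelW (pW : profile n) : profile n := [ffun i => s^-1 * pW i].
Definition relabelM (pM : profile n) : profile n := [ffun j => pM (s^-1 j)].

Lemma stable_relabel pW pM (mu : marriage n) :
  stable (relabelW pW) (relabelM pM) (mu * s) = stable pW pM mu.
Proof.
apply/forallP/forallP => st i; apply/forallP => j.
  have /forallP /(_ (s j)) := st i.
  by rewrite /blocking !ffunE invMg !permM !permK.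
have /forallP /(_ (s^-1 j)) := st i.
by rewrite /blocking !ffunE invMg !permM permK.
Qed.

Lemma in_some_stable_relabel w m pW pM :
  in_some_stable w (s m) (relabelW pW) (relabelM pM) = in_some_stable w m pW pM.
Proof.
apply/existsP/existsP => -[mu /andP[st e]].
  exists (mu * s^-1); rewrite -stable_relabel mulgKV st permM (eqP e) permK eqxx //.
by exists (mu * s); rewrite stable_relabel st permM (eqP e) eqxx.
Qed.

Lemma in_every_stable_relabel w m pW pM :
  in_every_stable w (s m) (relabelW pW) (relabelM pM) = in_every_stable w m pW pM.
Proof.
apply/forallP/forallP => h mu; apply/implyP => st.
  have := h (mu * s); rewrite stable_relabel st permM /=.
  by rewrite (inj_eq perm_inj).
have := h (mu * s^-1); rewrite -stable_relabel mulgKV st permM /= => /eqP <-.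
by rewrite permKV.
Qed.

End RelabelMen.

(* In the default marriage woman i marries man i. A woman i of P accepts a man
   j outside P above her default when (i, j) \in A, and man j accepts her above
   his default when (i, j) \in B, so a blocking pair of the default marriage is
   an element of A :&: B. Man i, when abandoned by woman i, takes w from her
   default husband; hence the couple (w, w) detects whether A and B meet. *)
Section Market.
Variables (n : nat) (w : 'I_n) (P : pred 'I_n).
Hypothesis wP : ~~ P w.
Implicit Types (A B : {set 'I_n * 'I_n}).

Definition bit_pairs : {set 'I_n * 'I_n} := [set p | P p.1 && (~~ P p.2 && (p.2 != w))].

(** A woman outside [P] other than [w] has man [w] as second choice; this closes the three-cycle of
    [exists_stable_meet]. *)
Definition wkey A (i j : 'I_n) :=
  if i == w then (if P j then 0 else if j == w then 1 else 2)
  else if P i then (if (i, j) \in A then 0 else if j == i then 1 else 2)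
  else (if j == i then 0 else if j == w then 1 else 2).

Definition mkey B (j i : 'I_n) :=
  if j == w then (if i == w then 0 else 1)
  else if P j then (if i == j then 0 else if i == w then 1 else 2)
  else (if (i, j) \in B then 0 else if i == j then 1 else 2).

Definition marketW A : profile n := [ffun i => rank_perm (wkey A i)].
Definition marketM B : profile n := [ffun j => rank_perm (mkey B j)].

Variables A B : {set 'I_n * 'I_n}.
Hypotheses (sA : A \subset bit_pairs) (sB : B \subset bit_pairs).

Let inA i j : (i, j) \in A -> [/\ P i, ~~ P j & j != w].
Proof. by move=> /(subsetP sA); rewrite inE => /= /and3P[]. Qed.

Let inB i j : (i, j) \in B -> [/\ P i, ~~ P j & j != w].
Proof. by move=> /(subsetP sB); rewrite inE => /= /and3P[]. Qed.

Let Pneq i j : P i -> ~~ P j -> i != j.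
Proof. by move=> Pi; apply: contraNneq => <-. Qed.

Let notPB i j : ~~ P i -> (i, j) \in B = false.
Proof. by move=> nPi; apply/negP => /inB [Pi]; rewrite Pi in nPi. Qed.
Let PA i j : P j -> (i, j) \in A = false.
Proof. by move=> nPi; apply/negP => /inA [_]; rewrite nPi. Qed.

Let no_block mu i j : stable (marketW A) (marketM B) mu ->
  wkey A i j < wkey A i (mu i) -> mkey B j i < mkey B j ((mu^-1)%g j) -> False.
Proof.
move=> /forallP/(_ i)/forallP/(_ j); rewrite /blocking !ffunE => nb h1 h2.
by rewrite !rank_perm_lt in nb.
Qed.

Let stable_intro (mu : marriage n) :
  (forall i j, j != mu i -> wkey A i j <= wkey A i (mu i) ->
     mkey B j i <= mkey B j ((mu^-1)%g j) -> False) ->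
  stable (marketW A) (marketM B) mu.
Proof.
move=> h; apply/forallP => i; apply/forallP => j; rewrite /blocking !ffunE.
apply/negP => /andP[h1 h2]; apply: (h i j); try exact: rank_perm_le.
by apply: contraTneq h1 => ->; rewrite ltnn.
Qed.

Let invP (mu : marriage n) i j : ((mu^-1)%g j == i) = (mu i == j).
Proof. by rewrite (can2_eq (permKV mu) (permK mu)) eq_sym. Qed.

(** Only [w] and the women of [P] may want another man: [w] is refused by the men of [P], who have
    their first choice, and the others are refused because [A] and [B] are disjoint. *)
Lemma stable_default : [disjoint A & B] -> stable (marketW A) (marketM B) 1%g.
Proof.
move=> dAB; apply: stable_intro => i j; rewrite invg1 !perm1 => ji.
rewrite /wkey; case: (eqVneq i w) ji => [-> | iw] ji.
  rewrite (negbTE wP) (negbTE ji); case: ifP => // Pj _.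
  by rewrite /mkey (negbTE ji) Pj !eqxx eq_sym (negbTE ji).
case: (boolP (P i)) => Pi; last by rewrite (negbTE ji) eqxx; case: ifP.
rewrite eqxx (negbTE ji) (PA _ Pi); case: ifP => // ijA _.
have [_ Pj jw] := inA ijA; rewrite /mkey (negbTE jw) (negbTE Pj) (notPB _ Pj) eqxx.
rewrite (eq_sym i) (negbTE ji); case: ifP => // ijB _.
by have := disjointFr dAB ijA; rewrite ijB.
Qed.

(** A woman i of [P] keeps man i: if she held a man j with (i, j) in [A], then (i, j) is not in [B]
    and woman j and man j would block; with any other man, she and man i would block. The men whom
    [w] prefers to man [w] are thus taken. *)
Lemma stable_disjoint mu : [disjoint A & B] -> stable (marketW A) (marketM B) mu -> mu w = w.
Proof.
move=> dAB st.
have fixP i : P i -> mu i = i.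
  move=> Pi; apply/eqP; apply/negP => /negP mi.
  have iw := Pneq Pi wP.
  case: (boolP ((i, mu i) \in A)) => ijA.
    have [_ Pj jw] := inA ijA; have ij := Pneq Pi Pj.
    have ijB := disjointFr dAB ijA.
    apply: (@no_block mu (mu i) (mu i) st).
      rewrite /wkey (negbTE jw) (negbTE Pj) eqxx; case: eqP => [/perm_inj e|]; last by case: ifP.
      by rewrite e eqxx in ij.
    by rewrite permK /mkey (negbTE jw) (negbTE Pj) ijB (notPB _ Pj) eqxx (negbTE ij).
  apply: (@no_block mu i i st).
    by rewrite /wkey (negbTE iw) Pi (PA _ Pi) eqxx (negbTE ijA) (negbTE mi).
  by rewrite /mkey (negbTE iw) Pi eqxx invP (negbTE mi); case: ifP.
apply/eqP; apply/negP => /negP mw; apply: (@no_block mu w w st).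
  rewrite /wkey (negbTE wP) eqxx; case: ifP => [/fixP /perm_inj e | _]; last by rewrite (negbTE mw).
  by rewrite e eqxx in mw.
by rewrite /mkey eqxx invP (negbTE mw).
Qed.

(** If [w] had man [w], a man of [P] without his default wife would block with her. This forces the
    default on [P], then on the other women, and [(i0, j0)] blocks the default marriage. *)
Lemma stable_meet i0 j0 mu : (i0, j0) \in A -> (i0, j0) \in B ->
  stable (marketW A) (marketM B) mu -> mu w != w.
Proof.
move=> hA hB st; apply/negP => /eqP mw.
have fixP i : P i -> mu i = i.
  move=> Pi; apply/eqP; apply/negP => /negP mi; have iw := Pneq Pi wP.
  apply: (@no_block mu w i st).
    by rewrite mw /wkey eqxx Pi (negbTE wP).
  by rewrite /mkey (negbTE iw) Pi !invP (negbTE mi) mw eqxx eq_sym (negbTE iw).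
have fixQ j : ~~ P j -> j != w -> mu j = j.
  move=> Pj jw; apply/eqP; apply/negP => /negP mj.
  apply: (@no_block mu j j st).
    by rewrite /wkey (negbTE jw) (negbTE Pj) eqxx (negbTE mj); case: ifP.
  rewrite /mkey (negbTE jw) (negbTE Pj) (notPB _ Pj) eqxx invP (negbTE mj).
  case: ifP => // /inB [/fixP]; rewrite permKV => e Pj' _.
  by move: mj; rewrite {1}e permKV eqxx.
have [Pi Pj jw] := inA hA.
apply: (@no_block mu i0 j0 st).
  by rewrite fixP // /wkey (negbTE (Pneq Pi wP)) Pi hA eqxx (PA _ Pi).
have -> : (mu^-1)%g j0 = j0 by apply/eqP; rewrite invP fixQ.
by rewrite /mkey (negbTE jw) (negbTE Pj) hB eqxx (notPB _ Pj).
Qed.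

(** An explicit witness is needed, since lying in every stable marriage could hold vacuously. It is
    the cycle in which [w] takes man [i0], woman [i0] takes man [j0] and woman [j0] takes man [w].
    Uniqueness of the common element excludes other blocking pairs. *)
Lemma exists_stable_meet i0 j0 : A :&: B = [set (i0, j0)] ->
  exists2 mu, stable (marketW A) (marketM B) mu & mu w != w.
Proof.
move=> AB; have := set11 (i0, j0); rewrite -AB inE => /andP[hA hB].
have uniqAB i j : (i, j) \in A -> (i, j) \in B -> i = i0 /\ j = j0.
  move=> h1 h2; have : (i, j) \in A :&: B by rewrite inE h1.
  by rewrite AB inE => /eqP[-> ->].
have [Pi Pj jw] := inA hA; have iw := Pneq Pi wP; have ij := Pneq Pi Pj.
pose mu : marriage n := (tperm w i0 * tperm w j0)%g.
have muw : mu w = i0 by rewrite permM tpermL tpermD // eq_sym.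
have mui : mu i0 = j0 by rewrite permM tpermR tpermL.
have muj : mu j0 = w by rewrite permM (@tpermD _ w i0 j0) ?tpermR // eq_sym.
have muD x : x != w -> x != i0 -> x != j0 -> mu x = x.
  by move=> xw xi xj; rewrite permM (@tpermD _ w i0 x) 1?tpermD // eq_sym.
have invE x y : mu x = y -> (mu^-1)%g y = x by move=> <-; rewrite permK.
have vi := invE _ _ muw; have vj := invE _ _ mui; have vw := invE _ _ muj.
have vD x : x != w -> x != i0 -> x != j0 -> (mu^-1)%g x = x.
  by move=> *; apply: invE; exact: muD.
exists mu; last by rewrite muw.
apply: stable_intro => i j; rewrite /wkey; case: (eqVneq i w) => [-> | niw].
  (* All men of [P] share key 0 for [w], so she may prefer another one to [i0]; that man still has
     his default wife. *)
  rewrite muw Pi => ji; case: ifP => [Pj' _ | _]; last by case: ifP.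
  have nw := Pneq Pj' wP.
  rewrite vD ?(Pneq Pj' Pj) // /mkey (negbTE nw) Pj' eqxx eq_sym (negbTE nw).
  by rewrite eqxx.
case: (eqVneq i i0) => [-> | ni].
  rewrite mui Pi hA => jj; case: ifP => [jA _ | _]; last by case: ifP.
  have [_ Pj' jw'] := inA jA; have nij := Pneq Pi Pj'.
  rewrite vD //; last by rewrite eq_sym.
  rewrite /mkey (negbTE jw') (negbTE Pj') eqxx (negbTE nij) (notPB _ Pj').
  case: ifP => // jB _; have [_ e] := uniqAB _ _ jA jB.
  by rewrite e eqxx in jj.
case: (boolP (P i)) => Pi'.
  rewrite muD ?(Pneq Pi' Pj) // => ji; rewrite (negbTE ji) eqxx (PA _ Pi').
  case: ifP => // jA _; have [_ Pj' jw'] := inA jA.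
  have nij := Pneq Pi' Pj'; have nij0 := Pneq Pi Pj'.
  rewrite /mkey (negbTE jw') (negbTE Pj') (negbTE nij).
  case: ifP => [jB _ | jB].
    by have [e _] := uniqAB _ _ jA jB; rewrite e eqxx in ni.
  case: (eqVneq j j0) => [-> | nj]; first by rewrite vj hB.
  by rewrite vD // ?(notPB _ Pj') ?eqxx // eq_sym.
case: (eqVneq i j0) => [-> | nj].
  rewrite muj => nj; rewrite (negbTE nj) [w == j0]eq_sym (negbTE jw) eqxx.
  case: (eqVneq j j0) => // -> _.
  by rewrite /mkey (negbTE jw) (negbTE Pj) vj hB eqxx (notPB _ Pj).
rewrite muD // => ji; rewrite (negbTE ji) eqxx; by case: ifP.
Qed.

Lemma in_some_stable_disjoint : [disjoint A & B] ->
  in_some_stable w w (marketW A) (marketM B).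
Proof. by move=> dAB; apply/existsP; exists 1%g; rewrite stable_default // perm1 eqxx. Qed.

Lemma in_every_stable_disjoint : [disjoint A & B] ->
  in_every_stable w w (marketW A) (marketM B).
Proof.
by move=> dAB; apply/forallP => mu; apply/implyP => st; rewrite stable_disjoint.
Qed.

Lemma in_some_stable_meet p : A :&: B = [set p] ->
  ~~ in_some_stable w w (marketW A) (marketM B).
Proof.
case: p => i j AB; have := set11 (i, j); rewrite -AB inE => /andP[hA hB].
apply/existsP => -[mu /andP[st mw]].
by have := stable_meet hA hB st; rewrite mw.
Qed.

Lemma in_every_stable_meet p : A :&: B = [set p] ->
  ~~ in_every_stable w w (marketW A) (marketM B).
Proof.
case: p => i j /exists_stable_meet [mu st mw].
by apply/forallP => /(_ mu); rewrite st (negbTE mw).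
Qed.

End Market.

Lemma config_gt0 (E : finType) m : #|E| = m.*2.+1 -> 0 < #|[set z | @config E m z]|.
Proof.
move=> cE.
have : 0 < #|[set T : {set E} | #|T| == m]| by rewrite card_draws bin_gt0 cE; lia.
case/card_gt0P=> T; rewrite inE => cT.
have : 0 < #|~: T| by have := cardsC T; rewrite (eqP cT); lia.
case/card_gt0P=> i; rewrite inE => iT.
apply/card_gt0P; exists ((T, i), (set0, set0)).
by rewrite inE /config /partition_pair cT iT /= !inE !sub0set.
Qed.

(** * Reduction from disjointness and choice of constants *)

Section Reduction.
Variables (n : nat) (w m : 'I_n).

Definition low_women (i : 'I_n) := (i != w) && (i < n./2).

Lemma card_ord_ltn h : h <= n -> #|[set i : 'I_n | i < h]| = h.
Proof. by move=> hn; rewrite -sum1dep_card -(big_ord_widen n (fun=> 1)) // sum1_card card_ord. Qed.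

Lemma card_bit_pairs : n./2.-1 * (n - n./2).-1 <= #|bit_pairs w low_women|.
Proof.
pose L := [set i : 'I_n | i < n./2].
have -> : bit_pairs w low_women = setX (L :\ w) (~: L :\ w).
  apply/setP => -[i j]; rewrite !inE /low_women /= -leqNgt.
  by case: (eqVneq j w); rewrite ?andbF ?andbT //= -leqNgt.
have hn : n./2 <= n by lia.
have cL : #|L| = n./2 by rewrite card_ord_ltn.
rewrite cardsX; apply: leq_mul.
  by have := cardsD1 w L; rewrite cL; case: (w \in L) => /=; lia.
have := cardsC L; have := cardsD1 w (~: L); rewrite cL card_ord.
by case: (w \in ~: L) => /=; lia.
Qed.

Variable f : forall w m : 'I_n, profile n -> profile n -> bool.
Hypothesis f_relabel : forall (s : {perm 'I_n}) i j pW pM,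
  f i (s j) (relabelW s pW) (relabelM s pM) = f i j pW pM.
Hypothesis f_disjoint : forall A B : {set 'I_n * 'I_n},
  A \subset bit_pairs w low_women -> B \subset bit_pairs w low_women ->
  [disjoint A & B] -> f w w (marketW w low_women A) (marketM w low_women B).
Hypothesis f_meet : forall (A B : {set 'I_n * 'I_n}) p,
  A \subset bit_pairs w low_women -> B \subset bit_pairs w low_women ->
  A :&: B = [set p] -> ~~ f w w (marketW w low_women A) (marketM w low_women B).

(** Serves both predicates: [f] is known only through its invariance and its values on disjoint and
    on uniquely meeting sets. *)
Lemma rcost_market_bound (R : realFieldType) (Q : rproto R (profile n) (profile n)) :
  1000 <= n -> rcorrect (f w m) Q -> n ^ 2 <= 1000 * 400 * rcost Q.
Proof.
move=> n_big corr.
(* [bit_pairs] has about n^2/4 elements, which leaves room for 2k+1; dividing by 300 > 33 * 8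
   ensures [dk] for large k. *)
pose k := n ^ 2 %/ 64; pose d := k %/ 300.
have k_big : 4000 <= k by rewrite /k leq_divRL // -mulnn; nia.
have le_bits : k.*2.+1 <= #|bit_pairs w low_women|.
  by apply: leq_trans card_bit_pairs; rewrite /k -mulnn; nia.
pose phi (e : 'I_k.*2.+1) := enum_val (widen_ord le_bits e).
have phi_inj : injective phi.
  by move=> x y /enum_val_inj /(congr1 val) /= /val_inj.
have phiS (a : {set 'I_k.*2.+1}) : phi @: a \subset bit_pairs w low_women.
  by apply/subsetP => _ /imsetP[e _ ->]; exact: enum_valP.
have cE : #|'I_k.*2.+1| = k.*2.+1 by rewrite card_ord.
pose V := [set z | @config 'I_k.*2.+1 k z].
(* Renaming the men by [s] moves the couple (w, w) of the market to (w, m). *)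
pose s := tperm w m.
pose X (a : {set 'I_k.*2.+1}) := relabelW s (marketW w low_women (phi @: a)).
pose Y (b : {set 'I_k.*2.+1}) := relabelM s (marketM w low_women (phi @: b)).
have fXY a b : f w m (X a) (Y b) = f w w (marketW w low_women (phi @: a)) (marketM w low_women (phi @: b)).
  by rewrite -[RHS](f_relabel s) tpermL.
have dk : 33 * (8 * d + 11) <= k.+1 by rewrite /d; lia.
have cfg z : z \in V -> z.2.1 :&: z.2.2 = set0 /\ (z.1.2 |: z.2.1) :&: (z.1.2 |: z.2.2) = [set z.1.2].
  rewrite inE => /andP[/andP[_ iT] /andP[]]; rewrite !powersetE => /subsetP aS /subsetP bT.
  have ab : z.2.1 :&: z.2.2 = set0.
    apply/setP => x; rewrite !inE; apply/negP => /andP[/aS xS /bT xT].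
    by move: xS; rewrite !inE xT andbF.
  by rewrite -setUIr ab setU0.
have d_le : d <= 8 * rcost Q + 9.
  apply: (@rcost_lower_bound _ _ _ V (fun z => X z.2.1) (fun z => X (z.1.2 |: z.2.1))
     (fun z => Y z.2.2) (fun z => Y (z.1.2 |: z.2.2)) d R Q (f w m)) => //.
  - exact: config_gt0.
  (* [X] depends on Alice's set alone and [Y] on Bob's, so a rectangle of profiles pulls back to a
     rectangle of sets. *)
  - move=> A B; have := corruption_disj (A \o X) (B \o Y) cE dk.
    rewrite /= (_ : [set z in V | A (X z.2.1) && B (Y z.2.2)] =
      [set z | config k z && (A (X z.2.1) && B (Y z.2.2))]); last by apply/setP => z; rewrite !in_set.
    rewrite (_ : [set z in V | A (X (z.1.2 |: z.2.1)) && B (Y (z.1.2 |: z.2.2))] =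
      [set z | config k z && (A (X (z.1.2 |: z.2.1)) && B (Y (z.1.2 |: z.2.2)))]) //.
    by apply/setP => z; rewrite !in_set.
  - move=> z /cfg [e _]; rewrite fXY; apply: f_disjoint => //.
    by rewrite -setI_eq0 -imsetI ?e ?imset0 //; move=> ? ? _ _; exact: phi_inj.
  - move=> z /cfg [_ e]; rewrite fXY; apply: (@f_meet _ _ (phi z.1.2)) => //.
    by rewrite -imsetI ?e ?imset_set1 //; move=> ? ? _ _; exact: phi_inj.
(* As k >= 4000 gives d >= 13, the cost is positive and absorbs the additive constants. *)
by move: d_le k_big; rewrite /d /k; lia.
Qed.

End Reduction.

(* Omega(n^2): there are constants k > 0 and N such that for all n >= N, every
   fixed pair (w,m), and every randomized protocol (Alice holds pW, Bob pM)
   deciding the predicate with error <= 1/3, the cost is at least n^2 / k. *)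
Theorem theorem11 :
  exists (k N : nat), (0 < k)%N /\
    forall (n : nat), (N <= n)%N -> forall (w m : 'I_n) (R : realFieldType),
      (forall Q : rproto R (profile n) (profile n),
         rcorrect (fun pW pM => in_some_stable w m pW pM) Q ->
         (n ^ 2 <= k * rcost Q)%N) /\
      (forall Q : rproto R (profile n) (profile n),
         rcorrect (fun pW pM => in_every_stable w m pW pM) Q ->
         (n ^ 2 <= k * rcost Q)%N).
Proof.
exists (1000 * 400), 1000; split=> // n n_big w m R.
have wP : ~~ low_women w w by rewrite /low_women eqxx.
split=> Q.
  apply: (@rcost_market_bound _ _ _ (@in_some_stable n)) => //.
  - exact: in_some_stable_relabel.
  - by move=> A B sA sB; exact: in_some_stable_disjoint.
  - by move=> A B p sA sB; exact: in_some_stable_meet.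
apply: (@rcost_market_bound _ _ _ (@in_every_stable n)) => //.
- exact: in_every_stable_relabel.
- by move=> A B sA sB; exact: in_every_stable_disjoint.
- by move=> A B p sA sB; exact: in_every_stable_meet.
Qed.
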